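(* Let $\mathbb{K}$ be a non-Archimedean valued field with valuation $|\cdot|$ and let $\mathcal{X}$ be a finite dimensional non-Archimedean Banach space over $\mathbb{K}$ with norm $\|\cdot\|$. Let $(\{f_j\}_{j=1}^n,\{\tau_j\}_{j=1}^n)$ and $(\{g_k\}_{k=1}^n,\{\omega_k\}_{k=1}^n)$ be orthonormal bases for $\mathcal{X}$. If $M,N\subseteq\{1,\dots,n\}$ are such that $$\max_{j\in M,\,k\in N}|g_k(\tau_j)|<1,$$ then for all $x\in\mathcal{X}$, $$\|x\|\leq\left(\frac{1}{1-\max_{j\in M,\,k\in N}|g_k(\tau_j)|}\right)\max\left\{\max_{j\in M^c}|f_j(x)|,\ \max_{k\in N^c}|g_k(x)|\right\}.$$ In particular, if $x\in\mathcal{X}$ is supported on $M$ in the expansion using the basis $(\{f_j\}_{j=1}^n,\{\tau_j\}_{j=1}^n)$ and $x$ is supported on $N$ in the expansion using the basis $(\{g_k\}_{k=1}^n,\{\omega_k\}_{k=1}^n)$, then $x=0$.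
   Context: A non-Archimedean Banach space over $\mathbb{K}$ is a complete normed space whose norm satisfies $\|x+y\|\leq\max\{\|x\|,\|y\|\}$. Let $\mathcal{X}$ be a finite dimensional non-Archimedean Banach space over $\mathbb{K}$, let $\{\tau_j\}_{j=1}^n$ be a basis for $\mathcal{X}$ and let $\{f_j\}_{j=1}^n$ be the coordinate functionals associated with $\{\tau_j\}_{j=1}^n$ (the linear functionals with $f_j(\tau_k)=\delta_{j,k}$). The pair $(\{f_j\}_{j=1}^n,\{\tau_j\}_{j=1}^n)$ is said to be an orthonormal basis for $\mathcal{X}$ if (i) $\|\tau_j\|\leq 1$ for all $1\leq j\leq n$, and (ii) $\|f_j\|\leq 1$ for all $1\leq j\leq n$, where $\|f\|=\sup_{x\in\mathcal{X}\setminus\{0\}}|f(x)|/\|x\|$. For $M\subseteq\{1,\dots,n\}$, $M^c$ denotes the complement of $M$ in $\{1,\dots,n\}$. A vector $x$ is supported on $M$ in the expansion using $(\{f_j\}_{j=1}^n,\{\tau_j\}_{j=1}^n)$ if $f_j(x)=0$ for all $j\in M^c$ (and similarly for $N$ and $(\{g_k\}_{k=1}^n,\{\omega_k\}_{k=1}^n)$). A maximum over an empty index set is taken to be $0$. *)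

(* Defs.v *)
From HB Require Import structures.
From mathcomp Require Import all_boot all_order all_algebra.
From mathcomp Require Import classical_sets reals constructive_ereal ereal.

Set Implicit Arguments.
Unset Strict Implicit.
Unset Printing Implicit Defensive.

Import Order.TTheory GRing.Theory Num.Theory.
Local Open Scope ring_scope.

(* The normed modules of MathComp-Analysis require numFieldType scalars, whose
   norm takes values in the field itself and satisfies `|2| = 2; this excludes
   non-Archimedean fields, so valuations and norms are plain functions into a
   realType. *)

Section NonArchimedean.
Variables (R : realType) (K : fieldType).

Definition nonarch_valuation (v : K -> R) : Prop :=
  [/\ forall a, 0 <= v a,
      forall a, v a = 0 <-> a = 0,
      forall a b, v (a * b) = v a * v b &
      forall a b, v (a + b) <= Num.max (v a) (v b)].

Variables (v : K -> R) (X : vectType K).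

Definition nonarch_norm (norm : X -> R) : Prop :=
  [/\ forall x, 0 <= norm x,
      forall x, norm x = 0 <-> x = 0,
      forall a x, norm (a *: x) = v a * norm x &
      forall x y, norm (x + y) <= Num.max (norm x) (norm y)].

Definition cauchy_seq (norm : X -> R) (u : nat -> X) : Prop :=
  forall e : R, 0 < e -> exists p : nat,
    forall k l : nat, (p <= k)%N -> (p <= l)%N -> norm (u k - u l) < e.

Definition converges_to (norm : X -> R) (u : nat -> X) (x : X) : Prop :=
  forall e : R, 0 < e -> exists p : nat,
    forall k : nat, (p <= k)%N -> norm (u k - x) < e.

Definition nonarch_banach (norm : X -> R) : Prop :=
  nonarch_norm norm /\
  (forall u, cauchy_seq norm u -> exists x, converges_to norm u x).

(* The supremum is taken in \bar R: K need not be complete, so a linear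
   functional on X may be unbounded, and the real-valued sup would then be 0.
   On the zero space the supremum is -oo. *)
Definition functional_norm (norm : X -> R) (f : {linear X -> K^o}) : \bar R :=
  ereal_sup [set (v (f x) / norm x)%:E | x in [set x : X | x <> 0]]%classic.

Variable n : nat.

Definition coordinate_functionals (tau : n.-tuple X)
    (f : 'I_n -> {linear X -> K^o}) : Prop :=
  forall j k : 'I_n, f j (tnth tau k) = (j == k)%:R.

Definition orthonormal_basis (norm : X -> R)
    (f : 'I_n -> {linear X -> K^o}) (tau : n.-tuple X) : Prop :=
  [/\ basis_of fullv tau,
      coordinate_functionals tau f,
      forall j, norm (tnth tau j) <= 1 &
      forall j, (functional_norm norm (f j) <= 1)%E].

Definition supported_on (f : 'I_n -> {linear X -> K^o}) (M : {set 'I_n})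
    (x : X) : Prop :=
  forall j, j \in ~: M -> f j x = 0.

(* Since v >= 0, starting from 0 leaves nonempty maxima unchanged and gives
   empty maxima the value 0. *)
Definition max_coord (f : 'I_n -> {linear X -> K^o}) (A : {set 'I_n})
    (x : X) : R :=
  \big[Num.max/0]_(j in A) v (f j x).

Definition max_cross (g : 'I_n -> {linear X -> K^o}) (tau : n.-tuple X)
    (M N : {set 'I_n}) : R :=
  \big[Num.max/0]_(j in M) \big[Num.max/0]_(k in N) v (g k (tnth tau j)).

End NonArchimedean.

(* Main.v *)
Require Import Defs.
From HB Require Import structures.
From mathcomp Require Import all_boot all_order all_algebra.
From mathcomp Require Import classical_sets reals constructive_ereal ereal.

Set Implicit Arguments.
Unset Strict Implicit.
Unset Printing Implicit Defensive.

Import Order.TTheory GRing.Theory Num.Theory.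
Local Open Scope ring_scope.

(** In an orthonormal basis the norm is the maximum of the moduli of the
    coordinates: [v (f j x) <= norm x] because [f j] has norm at most 1, and
    expanding [x] along the unit-bounded [tau] with the strong triangle
    inequality gives the other direction.

    Put [c := max_cross v g tau M N] and let [B] be the maximum of the
    coordinates of [x] outside [M] (for [f]) and outside [N] (for [g]).  By the
    above, some coordinate [g k x] dominates [norm x].  For [k] outside [N] it
    is at most [B].  For [k] in [N], expand it as the sum over [j] of
    [f j x * g k (tau j)]: the terms with [j] in [M] are at most [c * norm x],
    and the others at most [B], since [v (g k (tau j)) <= 1].  Hence
    [norm x <= max (c * norm x) B], and as [c < 1] the first alternative can
    only hold for [norm x = 0].  So in fact [norm x <= B]
    ([norm_le_max_coord]), which is stronger than the bound with the factor
    [1 / (1 - c) >= 1]; when [x] is supported on both sides, [B = 0] and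
    [x = 0]. *)

(** Valuations and norms both satisfy the strong triangle inequality, so this
    serves for sums of scalars and of vectors alike. *)
Lemma ultrametric_sum_le (R : realType) (V : nmodType) (p : V -> R)
    (pD : forall x y, p (x + y) <= Num.max (p x) (p y))
    (I : finType) (F : I -> V) (r : R) :
  p 0 <= r -> (forall i, p (F i) <= r) -> p (\sum_i F i) <= r.
Proof.
move=> p0 pF; apply: (big_ind (fun z => p z <= r)) => // x y xr yr.
by apply: le_trans (pD x y) _; rewrite ge_max xr yr.
Qed.

Section OrthonormalBases.
Variables (R : realType) (K : fieldType) (v : K -> R).
Hypothesis hv : nonarch_valuation v.
Variables (X : vectType K) (norm : X -> R).
Hypothesis hnorm : nonarch_norm v norm.
Variable n : nat.
Implicit Types (f g : 'I_n -> {linear X -> K^o}) (tau omega : n.-tuple X).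

Lemma orthonormal_expansion f tau x :
  orthonormal_basis v norm f tau -> x = \sum_j f j x *: tnth tau j.
Proof.
case=> btau ftau _ _; rewrite {1}(coord_basis btau (memvf x)).
apply: eq_bigr => j _; rewrite -tnth_nth; congr (_ *: _).
rewrite [in RHS](coord_basis btau (memvf x)) linear_sum (bigD1 j) //=.
rewrite big1 => [|k kj]; rewrite linearZ -tnth_nth /= ftau.
  by rewrite eqxx addr0 /GRing.scale /= mulr1.
by rewrite eq_sym (negPf kj) scaler0.
Qed.

Lemma coordinate_le_norm f tau j x :
  orthonormal_basis v norm f tau -> v (f j x) <= norm x.
Proof.
case: hv hnorm => _ v0 _ _ [norm_ge0 norm0 _ _] [_ _ _ /(_ j) fj1].
(* The supremum runs over nonzero vectors only. *)
have [->|/eqP x0] := eqVneq x 0.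
  by rewrite linear0 (proj2 (v0 _) erefl).
have xgt0 : 0 < norm x.
  by rewrite lt_def norm_ge0 andbT; apply/eqP => /norm0.
have : ((v (f j x) / norm x)%:E <= 1)%E.
  by apply: le_trans fj1; apply: ereal_sup_ubound; exists x.
by rewrite lee_fin ler_pdivrMr // mul1r.
Qed.

Lemma norm_le_coordinates f tau x r :
  orthonormal_basis v norm f tau -> 0 <= r ->
  (forall j, v (f j x) <= r) -> norm x <= r.
Proof.
case: hv hnorm => v_ge0 _ _ _ [norm_ge0 norm0 normZ normD] hf r0 fr.
rewrite (orthonormal_expansion x hf).
apply: ultrametric_sum_le => // [|j]; first by rewrite (proj2 (norm0 _) erefl).
have [_ _ tau1 _] := hf.
by rewrite normZ; apply: le_trans (fr j); rewrite ler_piMr.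
Qed.

Lemma cross_le f tau g omega j k :
  orthonormal_basis v norm f tau -> orthonormal_basis v norm g omega ->
  v (g k (tnth tau j)) <= 1.
Proof.
move=> [_ _ tau1 _] hg.
exact: le_trans (coordinate_le_norm k (tnth tau j) hg) (tau1 j).
Qed.

Lemma le_max_cross g tau (M N : {set 'I_n}) j k :
  j \in M -> k \in N -> v (g k (tnth tau j)) <= max_cross v g tau M N.
Proof.
move=> jM kN; rewrite /max_cross.
apply: le_trans (le_bigmax_cond _ _ jM).
exact: (le_bigmax_cond _ (fun k => v (g k (tnth tau j))) kN).
Qed.

Lemma coordinate_change g f tau k x :
  orthonormal_basis v norm f tau ->
  g k x = \sum_j f j x * g k (tnth tau j).
Proof.
move=> hf; rewrite {1}(orthonormal_expansion x hf) linear_sum.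
by apply: eq_bigr => j _; rewrite linearZ.
Qed.

(** The sharp form of the uncertainty principle, with constant 1: the
    ultrametric turns [norm x <= c * norm x + B] into a maximum, so the term
    with [c < 1] drops out instead of costing a factor [1 / (1 - c)]. *)
Lemma norm_le_max_coord f tau g omega (M N : {set 'I_n}) x :
  orthonormal_basis v norm f tau -> orthonormal_basis v norm g omega ->
  max_cross v g tau M N < 1 ->
  norm x <= Num.max (max_coord v f (~: M) x) (max_coord v g (~: N) x).
Proof.
case: hv hnorm => v_ge0 v0 vM vD [norm_ge0 _ _ _] hf hg c1.
set c := max_cross _ _ _ _ _ in c1 *; set B := Num.max _ _.
have B0 : 0 <= B by rewrite le_max bigmax_ge_id.
have fB j : j \notin M -> v (f j x) <= B.
  rewrite -finset.in_setC => jM; rewrite le_max; apply/orP; left.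
  exact: (le_bigmax_cond _ (fun j => v (f j x)) jM).
have gB k : k \notin N -> v (g k x) <= B.
  rewrite -finset.in_setC => kN; rewrite le_max; apply/orP; right.
  exact: (le_bigmax_cond _ (fun k => v (g k x)) kN).
have : norm x <= Num.max (c * norm x) B.
  apply: (norm_le_coordinates hg) => [|k]; first by rewrite le_max B0 orbT.
  have [kN|/gB gkB] := boolP (k \in N); last by rewrite le_max gkB orbT.
  rewrite (coordinate_change g k x hf); apply: ultrametric_sum_le => // [|j].
    by rewrite (proj2 (v0 0) erefl) le_max B0 orbT.
  rewrite vM le_max; have [jM|/fB fjB] := boolP (j \in M); apply/orP.
    left; rewrite mulrC; apply: ler_pM => //; first exact: le_max_cross.
    exact: coordinate_le_norm hf.
  by right; apply: le_trans fjB; rewrite ler_piMr // (cross_le j k hf hg).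
rewrite le_max => /orP[xc|//]; apply: le_trans B0.
by rewrite leNgt; apply/negP => x0; move: xc; rewrite ler_pMl // leNgt c1.
Qed.

Lemma max_coord_supported f (M : {set 'I_n}) x :
  supported_on f M x -> max_coord v f (~: M) x = 0.
Proof.
case: hv => _ v0 _ _ fM; apply: big1_idem => [|j /fM ->]; first exact: maxxx.
exact: (proj2 (v0 0)).
Qed.

End OrthonormalBases.

Theorem theorem3p4 (R : realType) (K : fieldType) (v : K -> R)
    (hv : nonarch_valuation v)
    (X : vectType K) (norm : X -> R) (hX : nonarch_banach v norm)
    (n : nat)
    (f : 'I_n -> {linear X -> K^o}) (tau : n.-tuple X)
    (g : 'I_n -> {linear X -> K^o}) (omega : n.-tuple X)
    (hf : orthonormal_basis v norm f tau)
    (hg : orthonormal_basis v norm g omega)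
    (M N : {set 'I_n})
    (hMN : max_cross v g tau M N < 1) :
  (forall x : X,
     norm x <= 1 / (1 - max_cross v g tau M N)
               * Num.max (max_coord v f (~: M) x) (max_coord v g (~: N) x))
  /\ (forall x : X, supported_on f M x -> supported_on g N x -> x = 0).
Proof.
have [hnorm _] := hX; have [norm_ge0 norm0 _ _] := hnorm.
have xB x := norm_le_max_coord hv hnorm x hf hg hMN.
split=> [x|x xM xN].
  apply: le_trans (xB x) _; rewrite ler_peMl //; first exact: le_trans (xB x).
  rewrite div1r invf_ge1 ?subr_gt0 // gerBl.
  exact: bigmax_ge_id.
apply/norm0/le_anti; rewrite norm_ge0 andbT.
by have := xB x; rewrite !(max_coord_supported hv) // maxxx.
Qed.
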